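(* Let $f$ be a locally univalent analytic function in the unit disk $\mathbb{D}$. If there is $t\ge 0$ such that $|P_f(z)|\ge 1+t$ for all $z\in\mathbb{D}$, then $$\operatorname{Re}\left\{1+z\frac{f''(z)}{f'(z)}\right\}\ge \frac{t}{2+t}\qquad\text{for all } z\in\mathbb{D}.$$
   Context: $\mathbb{D}=\{z\in\mathbb{C}:|z|<1\}$. A function $f$ analytic in $\mathbb{D}$ is locally univalent if $f'(z)\neq 0$ for all $z\in\mathbb{D}$. For such $f$, the pole function is $P_f(z)=z+2\,f'(z)/f''(z)\in\mathbb{C}\cup\{\infty\}$, with $P_f(z)=\infty$ when $f''(z)=0$, and $|\infty|=+\infty$. *)

(* Defs.v *)
From Stdlib Require Import Reals.
From Coquelicot Require Import Coquelicot.
Open Scope R_scope.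

Definition in_disk (z : C) : Prop := Cmod z < 1.

(* Analyticity is complex differentiability at every point of the open disk.
   A function on the disk is represented by a total function on [C], whose
   values off the disk are irrelevant: the disk is open and derivatives are
   only taken at its points. *)
Definition analytic_in_disk (f : C -> C) : Prop :=
  forall z : C, in_disk z -> @ex_derive C_AbsRing C_NormedModule f z.

(* [C_derive] is the complex derivative wherever that exists
   (see [is_C_derive_unique]). *)
Definition locally_univalent (f : C -> C) : Prop :=
  forall z : C, in_disk z -> C_derive f z <> RtoC 0.

(* [None] is the point at infinity. *)
Definition extended_C : Type := option C.

Definition extended_Cmod (w : extended_C) : Rbar :=
  match w with
  | Some a => Finite (Cmod a)
  | None => p_infty
  end.

Definition pole_function (f : C -> C) (z : C) : extended_C :=
  let f1 := C_derive f in
  let f2 := C_derive f1 in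
  if Ceq_dec (f2 z) (RtoC 0) then None
  else Some (z + RtoC 2 * (f1 z / f2 z))%C.

(* Main.v *)
Require Import Defs.
From Stdlib Require Import Reals Lra.
From Coquelicot Require Import Coquelicot.
Open Scope R_scope.

(** The theorem holds point by point.  Put [h = f''/f'] at a point [z] of the
    disk, and [u = z h].  Multiplying [P_f(z) = z + 2/h] by [h] turns the bound
    on the pole function into [(1 + t) |h| <= |2 + u|]
    ([pole_function_bound]), which also covers the infinite pole [h = 0].
    As [|u| <= |h|], this gives [(1 + t) |u| <= |2 + u|]: the point [u] lies
    in the set where the quotient of the distances to [0] and [-2] is at most
    [1/(1 + t)].  For [t > 0] this is the Apollonius disk whose diameter is
    the real segment from [-2/(2 + t)] to [2/t], and for [t = 0] it is the
    half-plane [Re u >= -1].  In both cases [Re u >= -2/(2 + t)], that is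
    [Re (1 + u) >= t/(2 + t)]
    ([Re_ge_of_Apollonius]). *)

Lemma Cmod_sqr (z : C) : Cmod z * Cmod z = fst z * fst z + snd z * snd z.
Proof.
unfold Cmod; rewrite sqrt_sqrt; [ring | nra].
Qed.

(** Squaring the hypothesis and dropping [Im u] leaves
    [t (t + 2) x^2 - 4 x - 4 <= 0] for [x = Re u], that is
    [((t + 2) x + 2) (t x - 2) <= 0]; were the first factor negative, [x]
    would be too, and both factors would be negative. *)
Lemma Re_ge_of_Apollonius (t : R) (u : C) :
  0 <= t -> (1 + t) * Cmod u <= Cmod (RtoC 2 + u) ->
  t / (2 + t) <= Re (RtoC 1 + u).
Proof.
intros ht hu.
assert (hsq : ((1 + t) * Cmod u) * ((1 + t) * Cmod u)
              <= Cmod (RtoC 2 + u) * Cmod (RtoC 2 + u)).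
{ pose proof (Cmod_ge_0 u); apply Rmult_le_compat; nra. }
replace ((1 + t) * Cmod u * ((1 + t) * Cmod u))
  with ((1 + t) * (1 + t) * (Cmod u * Cmod u)) in hsq by ring.
rewrite !Cmod_sqr in hsq.
destruct u as [x y]; simpl in *.
assert (hfactor : ((t + 2) * x + 2) * (t * x - 2) <= 0).
{ assert (0 <= t * (t + 2) * (y * y)) by
    (apply Rmult_le_pos; nra).
  nra. }
assert (hx : 0 <= (t + 2) * x + 2).
{ destruct (Rle_lt_dec 0 ((t + 2) * x + 2)) as [|hneg]; [assumption|].
  assert (x < 0) by nra.
  assert (t * x - 2 < 0) by nra.
  nra. }
apply Rmult_le_reg_r with (2 + t); [lra|].
replace (t / (2 + t) * (2 + t)) with t by (field; lra).
lra.
Qed.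

(** Clearing the denominator of [P_f] gives a form without the point at
    infinity, where the case [f''(z) = 0] needs no separate treatment. *)
Lemma pole_function_bound (f : C -> C) (z : C) (r : R) :
  C_derive f z <> RtoC 0 ->
  Rbar_le (Finite r) (extended_Cmod (pole_function f z)) ->
  let h := (C_derive (C_derive f) z / C_derive f z)%C in
  r * Cmod h <= Cmod (RtoC 2 + z * h)%C.
Proof.
intros hf1 hP h.
unfold pole_function in hP; simpl in hP.
destruct (Ceq_dec (C_derive (C_derive f) z) (RtoC 0)) as [hf2|hf2];
  simpl in hP.
- replace h with (RtoC 0) by (unfold h; rewrite hf2; field; assumption).
  rewrite Cmod_0, Rmult_0_r; apply Cmod_ge_0.
- replace (RtoC 2 + z * h)%C
    with ((z + RtoC 2 * (C_derive f z / C_derive (C_derive f) z)) * h)%C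
    by (unfold h; field; split; assumption).
  rewrite Cmod_mult.
  apply Rmult_le_compat_r; [apply Cmod_ge_0 | exact hP].
Qed.

Theorem theorem4p1 (f : C -> C) (hf : analytic_in_disk f)
  (hu : locally_univalent f) (t : R) (ht : 0 <= t)
  (hP : forall z : C, in_disk z ->
          Rbar_le (Finite (1 + t)) (extended_Cmod (pole_function f z))) :
  forall z : C, in_disk z ->
    t / (2 + t) <=
      Re (RtoC 1 + z * (C_derive (C_derive f) z / C_derive f z))%C.
Proof.
intros z hz.
pose proof (pole_function_bound f z (1 + t) (hu z hz) (hP z hz)) as hbound.
simpl in hbound.
set (h := (C_derive (C_derive f) z / C_derive f z)%C) in *.
apply Re_ge_of_Apollonius; [exact ht|].
apply Rle_trans with ((1 + t) * Cmod h); [|exact hbound].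
apply Rmult_le_compat_l; [lra|].
rewrite Cmod_mult.
pose proof (Cmod_ge_0 h).
unfold in_disk in hz; nra.
Qed.
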